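(* Let $\ell\ge 1$ be an integer and $n=2^\ell+2$. Let $G_\ell$ be the graph on vertices $v_1,\dots,v_n$ in which, for $0\le k\le \ell$ and $1\le i\le n-2^k$, the pair $v_iv_{i+2^k}$ is an edge if and only if $i-1$ or $i-2$ is a multiple of $2^k$ (for $k=0$ this gives the path $v_1v_2\cdots v_n$). Consider a plane straight-line embedding of $G_\ell$ in which the $x$-coordinates satisfy $x(v_1)<x(v_2)<\dots<x(v_n)$. Then the number of $x$-monotone paths in $G_\ell$ is $\Omega(1.7003^n)$ as $\ell\to\infty$.
   Context: A plane straight-line graph is a graph whose vertices are points in the plane and whose edges are straight segments between their endpoints, no two of which intersect except at common endpoints. A polygonal path $(w_1,\dots,w_t)$ is monotone in direction $\mathbf{u}\neq\mathbf{0}$ if $\langle \overrightarrow{w_iw_{i+1}},\mathbf{u}\rangle>0$ for all $i$; it is $x$-monotone if it is monotone in direction $(1,0)$. *)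

(* Defs.v *)
From HB Require Import structures.
From mathcomp Require Import all_boot all_order all_algebra.
From mathcomp Require Import reals.

Set Implicit Arguments.
Unset Strict Implicit.
Unset Printing Implicit Defensive.

Import Order.TTheory GRing.Theory Num.Theory.

Local Open Scope ring_scope.

Section PlaneStraightLineGraphs.
Variable R : realType.

Definition dot (u v : R * R) : R := u.1 * v.1 + u.2 * v.2.

Definition vec (a b : R * R) : R * R := (b.1 - a.1, b.2 - a.2).

Definition on_segment (a b z : R * R) : Prop :=
  exists t : R, [/\ 0 <= t, t <= 1 &
    z = ((1 - t) * a.1 + t * b.1, (1 - t) * a.2 + t * b.2)].

Variable T : finType.

(* A finite simple graph is given by its (symmetric, irreflexive) adjacency
   relation e, and p gives the positions of the vertices. *)
Definition plane_straight_line (e : rel T) (p : T -> R * R) : Prop :=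
  injective p /\
  forall a b c d : T, e a b -> e c d -> [set a; b] != [set c; d] ->
    forall z : R * R, on_segment (p a) (p b) z -> on_segment (p c) (p d) z ->
      exists v : T, [/\ v \in [set a; b], v \in [set c; d] & z = p v].

Definition graph_path (e : rel T) (s : seq T) : bool :=
  [&& (1 < size s)%N, uniq s & sorted e s].

Definition monotone (p : T -> R * R) (u : R * R) (s : seq T) : bool :=
  sorted (fun a b => 0 < dot (vec (p a) (p b)) u) s.

(* A path has no repeated vertex, so bounding its length by #|T| loses nothing.
   At most one of the two orientations of a path with at least one edge is
   monotone in direction u, so each monotone path is counted exactly once. *)
Definition num_monotone_paths (e : rel T) (p : T -> R * R) (u : R * R) : nat :=
  #|[set s : #|T|.-bseq T | graph_path e s && monotone p u s]|.

Definition num_x_monotone_paths (e : rel T) (p : T -> R * R) : nat :=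
  num_monotone_paths e p (1, 0).

End PlaneStraightLineGraphs.

Definition nvert (l : nat) : nat := (2 ^ l + 2)%N.

(* The vertex v_i (1 <= i <= n) is the ordinal i - 1, so the index of
   a : 'I_(nvert l) is a.+1; the bound i <= n - 2 ^ k is ltn_ord b. *)
Definition G_arc (l : nat) (a b : 'I_(nvert l)) : bool :=
  [exists k : 'I_l.+1,
     (b.+1 == a.+1 + 2 ^ k)%N &&
     ((a.+1 == 1 %[mod 2 ^ k])%N || (a.+1 == 2 %[mod 2 ^ k])%N)].

Definition G_adj (l : nat) : rel 'I_(nvert l) :=
  fun a b => G_arc a b || G_arc b a.

Lemma G_adj_sym (l : nat) : symmetric (@G_adj l).
Proof. by move=> a b; rewrite /G_adj orbC. Qed.

Lemma G_adj_irr (l : nat) : irreflexive (@G_adj l).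
Proof.
move=> a; rewrite /G_adj orbb; apply/negbTE/existsP => -[k /andP[/eqP h _]].
move: h; rewrite -[LHS]addn0 => /addnI/eqP.
by rewrite eq_sym expn_eq0.
Qed.

(* Main.v *)
Require Import Defs.
From HB Require Import structures.
From mathcomp Require Import all_boot all_order all_algebra.
From mathcomp Require Import reals.
From mathcomp Require Import zify lra.

Set Implicit Arguments.
Unset Strict Implicit.
Unset Printing Implicit Defensive.

Import Order.TTheory GRing.Theory Num.Theory.
Local Open Scope ring_scope.

(** The x-monotone paths are the directed paths for the orientation v_i -> v_j,
    i < j.  Keep only the edges of length 1, 2, 4 and 8, and let x_m and y_m be
    the numbers of directed paths from v_1 to v_(8m+1) and to v_(8m+2).
    Propagating these counts along one period of 8 vertices gives
      x_(m+1) >= 22 x_m + 27 y_m  and  y_(m+1) >= 37 x_m + 49 y_m.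
    This matrix has spectral radius (71 + sqrt 4725) / 2 = 69.869... , which is
    larger than 1.7003 ^ 8 = 69.856... *)

Section IncreasingWalks.
Local Open Scope nat_scope.
Variables (n : nat) (e : rel 'I_n) (x0 : 'I_n).

Definition incr_arc : rel 'I_n := fun a b => e a b && (a < b).

(* A walk is represented by its vertices after the initial vertex x0. *)
Definition walks_to (D : seq nat) : {set #|'I_n|.-bseq 'I_n} :=
  [set s : #|'I_n|.-bseq 'I_n | path incr_arc x0 s & val (last x0 s) \in D].

Definition num_walks (j : nat) : nat := #|walks_to [:: j]|.

Lemma card_walks_to (D : seq nat) :
  uniq D -> #|walks_to D| = \sum_(u <- D) num_walks u.
Proof.
elim: D => [|u D IH] /= => [_|/andP[uD Du]].
  by rewrite big_nil; apply: eq_card0 => s; rewrite !inE andbF.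
rewrite big_cons -IH // /num_walks -cardsUI.
have -> : walks_to [:: u] :&: walks_to D = set0.
  apply/setP=> s; rewrite !inE; apply/negbTE/negP.
  by move=> /andP[/andP[_ /eqP->] /andP[_]]; apply/negP.
by rewrite cards0 addn0; apply: eq_card => s; rewrite !inE -andb_orr.
Qed.

Lemma uniq_incr_walk (s : seq 'I_n) : path incr_arc x0 s -> uniq (x0 :: s).
Proof.
move=> sp; apply: (@sorted_uniq _ (fun a b : 'I_n => a < b)).
- by move=> b a c; apply: ltn_trans.
- by move=> a; rewrite /= ltnn.
- by apply: sub_path sp => a b /andP[].
Qed.

(** The strict bound leaves room for one more vertex in a sequence of bounded length. *)
Lemma size_incr_walk (s : seq 'I_n) : path incr_arc x0 s -> size s < #|'I_n|.
Proof.
by move=> /uniq_incr_walk /card_uniqP sE; rewrite -[_.+1]sE max_card.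
Qed.

Lemma num_walks_start : 0 < num_walks x0.
Proof.
by apply/card_gt0P; exists [bseq]; rewrite !inE /= eqxx.
Qed.

(** Appending [b] is injective and turns walks ending in [D] into walks ending at [b]. *)
Lemma num_walks_step (D : seq nat) (b : 'I_n) :
    uniq D -> (forall a : 'I_n, val a \in D -> incr_arc a b) ->
  \sum_(u <- D) num_walks u <= num_walks b.
Proof.
move=> Du Db; rewrite -card_walks_to //.
(* [insub_bseq] defaults to the empty sequence on an argument that is too long; by [size_incr_walk]
   this never happens on [walks_to D]. *)
pose f (s : #|'I_n|.-bseq 'I_n) : #|'I_n|.-bseq 'I_n :=
  insub_bseq _ (rcons s b).
have fE s : s \in walks_to D -> f s = rcons s b :> seq _.
  rewrite inE => /andP[sp _].
  by rewrite insubdK // -topredE /= ?size_rcons ?size_incr_walk.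
rewrite -(@card_in_imset _ _ f (walks_to D)); last first.
  move=> s t sD tD /(congr1 (fun u : _.-bseq _ => val u)).
  by rewrite /= !fE // => /rcons_inj[st]; apply: val_inj.
apply/subset_leq_card/subsetP => _ /imsetP[s sD ->].
rewrite inE fE // rcons_path last_rcons mem_head andbT.
by move: sD; rewrite inE => /andP[-> /Db].
Qed.

(** Prepending [x0] is injective. As [x0] is not in [D], a walk ending in [D] is nonempty, so the
    path it yields has at least one edge. *)
Lemma num_walks_total (D : seq nat) :
    uniq D -> val x0 \notin D ->
  \sum_(u <- D) num_walks u <=
  #|[set s : #|'I_n|.-bseq 'I_n |
      [&& 1 < size s, uniq s & sorted incr_arc s]]|.
Proof.
move=> Du x0D; rewrite -card_walks_to //.
pose f (s : #|'I_n|.-bseq 'I_n) : #|'I_n|.-bseq 'I_n :=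
  insub_bseq _ (x0 :: s).
have fE s : s \in walks_to D -> f s = x0 :: s :> seq _.
  by rewrite inE => /andP[sp _]; rewrite insubdK // -topredE /= ?size_incr_walk.
rewrite -(@card_in_imset _ _ f (walks_to D)); last first.
  move=> s t sD tD /(congr1 (fun u : _.-bseq _ => val u)).
  by rewrite /= (fE _ sD) (fE _ tD) => -[st]; apply: val_inj.
apply/subset_leq_card/subsetP => _ /imsetP[s sD ->].
rewrite inE fE //; move: sD; rewrite inE => /andP[sp sl].
rewrite uniq_incr_walk //= sp andbT.
by case: (val s) sl => //= x0D'; rewrite x0D' in x0D.
Qed.

End IncreasingWalks.

Section WalksInG.
Local Open Scope nat_scope.
Variables (l : nat) (x0 : 'I_(nvert l)).
Hypothesis l3 : 3 <= l.
Local Notation N := (num_walks (@G_adj l) x0).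

(** Indices start at 0 here, so the residues 1 and 2 of [G_arc] become 0 and 1. *)
Lemma G_incr_arc (k : nat) (a b : 'I_(nvert l)) :
    k <= l -> val b = a + 2 ^ k ->
    (a == 0 %[mod 2 ^ k]) || (a == 1 %[mod 2 ^ k]) ->
  incr_arc (@G_adj l) a b.
Proof.
move=> kl ba ak; rewrite /incr_arc ba -[X in X < _]addn0 ltn_add2l expn_gt0.
rewrite andbT; apply/orP; left; apply/existsP.
exists (Ordinal (kl : k < l.+1)) => /=.
rewrite ba -addSn eqxx /= -addn1 -[1 in X in X || _]add0n eqn_modDr.
by rewrite -[2 in X in _ || X]/(1 + 1) eqn_modDr.
Qed.

(** The residue condition can be put on [j], which agrees with its predecessor [j - 2 ^ k] modulo
    [2 ^ k]. *)
Lemma num_walks_G_step (j : nat) (ks : seq nat) :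
    j < nvert l -> uniq ks ->
    (forall k, k \in ks -> [&& k <= l, 2 ^ k <= j &
       (j == 0 %[mod 2 ^ k]) || (j == 1 %[mod 2 ^ k])]) ->
  \sum_(k <- ks) N (j - 2 ^ k) <= N j.
Proof.
move=> jn ksu ksP; rewrite -(big_map (fun k => j - 2 ^ k) xpredT N).
apply: (@num_walks_step _ _ _ _ (Ordinal jn)).
  rewrite map_inj_in_uniq // => k k' /ksP/and3P[_ kj _] /ksP/and3P[_ kj' _] E.
  by apply/eqP; rewrite -(@eqn_exp2l 2) //; apply/eqP; lia.
move=> a /mapP[k /ksP/and3P[kl kj jk] ak].
apply: (@G_incr_arc k) => //; first by rewrite /= ak subnK.
rewrite ak -(eqn_modDr (2 ^ k)) subnK // -[X in _ || X](eqn_modDr (2 ^ k)).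
by rewrite subnK // !modnDr.
Qed.

Lemma num_walks_G_period (m : nat) : m.+1 * 8 + 1 < nvert l ->
  22 * N (m * 8) + 27 * N (m * 8 + 1) <= N (m.+1 * 8) /\
  37 * N (m * 8) + 49 * N (m * 8 + 1) <= N (m.+1 * 8 + 1).
Proof.
move=> mn.
(* As [2 ^ k] divides 8 for [k <= 3], the residue condition at [m * 8 + j] depends on [j] only; [ds]
   lists the offsets of the predecessors. *)
have step j ks ds : j <= 9 -> uniq ks ->
    all (fun k => [&& k <= 3, 2 ^ k <= j &
       (j == 0 %[mod 2 ^ k]) || (j == 1 %[mod 2 ^ k])]) ks ->
    [seq j - 2 ^ k | k <- ks] = ds ->
    \sum_(d <- ds) N (m * 8 + d) <= N (m * 8 + j).
  move=> j9 ksu /allP ksP <-; rewrite big_map.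
  rewrite (eq_big_seq (fun k => N (m * 8 + j - 2 ^ k))); last first.
    by move=> k /ksP/and3P[_ kj _]; rewrite addnBA.
  apply: num_walks_G_step => //; first by lia.
  move=> k /ksP/and3P[k3 kj jk]; apply/and3P; split; [lia|lia|].
  have -> : m * 8 = m * 2 ^ (3 - k) * 2 ^ k by rewrite -mulnA -expnD subnK.
  by rewrite modnMDl.
(* With x and y at offsets 0 and 1, the lower bounds at offsets 2 to 9 are x + y, x + 2y, 3x + 3y,
   4x + 6y, 7x + 9y, 11x + 15y, 22x + 27y and 37x + 49y. *)
have := step 2 [:: 0; 1] [:: 1; 0] isT isT isT erefl.
have := step 3 [:: 0; 1] [:: 2; 1] isT isT isT erefl.
have := step 4 [:: 0; 1; 2] [:: 3; 2; 0] isT isT isT erefl.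
have := step 5 [:: 0; 1; 2] [:: 4; 3; 1] isT isT isT erefl.
have := step 6 [:: 0; 1] [:: 5; 4] isT isT isT erefl.
have := step 7 [:: 0; 1] [:: 6; 5] isT isT isT erefl.
have := step 8 [:: 0; 1; 2; 3] [:: 7; 6; 4; 0] isT isT isT erefl.
have := step 9 [:: 0; 1; 2; 3] [:: 8; 7; 5; 1] isT isT isT erefl.
rewrite !big_cons !big_nil !addn0 [m.+1 * 8]mulSnr -(addnA _ 8 1) -[8 + 1]/9.
lia.
Qed.

End WalksInG.

(* (2000, 2587) is close to a multiple of (1, 1.29376...), the left Perron
   eigenvector of [[22, 27], [37, 49]]. *)
Lemma num_walks_G_ge (R : realType) (l : nat) (x0 : 'I_(nvert l)) (m : nat) :
    (3 <= l)%N -> x0 = 0%N :> nat -> (m * 8 + 1 < nvert l)%N ->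
  2000 * (17003%:R / 10000%:R) ^+ (m * 8) <=
  2000 * (num_walks (@G_adj l) x0 (m * 8))%:R +
  2587 * (num_walks (@G_adj l) x0 (m * 8 + 1))%:R :> R.
Proof.
move=> l3 x00; elim: m => [|m IH] mn.
  have : (0 < num_walks (@G_adj l) x0 0)%N.
    by have := num_walks_start (@G_adj l) x0; rewrite x00.
  rewrite -(ler_nat R) mul0n expr0 => N0.
  have : 0 <= (num_walks (@G_adj l) x0 (0 + 1))%:R :> R by [].
  lra.
have /IH{}IH : (m * 8 + 1 < nvert l)%N by lia.
have [] := @num_walks_G_period l x0 l3 m mn.
rewrite -!(ler_nat R) (natrD _ (22 * _)) (natrD _ (37 * _)) !natrM => N8 N9.
rewrite [X in _ ^+ X]mulSnr exprD.
move: IH N8 N9; have N0_ge0 j : 0 <= (num_walks (@G_adj l) x0 j)%:R :> R by [].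
move: (N0_ge0 (m * 8)%N) (N0_ge0 (m * 8 + 1)%N).
move: (num_walks _ _ (m * 8))%:R (num_walks _ _ (m * 8 + 1))%:R => x y.
move: (num_walks _ _ _)%:R (num_walks _ _ _)%:R => x' y' x_ge0 y_ge0 IH N8 N9.
have r8_ge0 : 0 <= (17003%:R / 10000%:R) ^+ 8 :> R by apply: exprn_ge0; lra.
have r8_le : (17003%:R / 10000%:R) ^+ 8 <= 69857%:R / 1000%:R :> R by lra.
rewrite mulrA; apply: le_trans (ler_wpM2r r8_ge0 IH) _.
apply: (@le_trans _ _ ((2000 * x + 2587 * y) * (69857%:R / 1000%:R))).
  by apply: ler_wpM2l => //; lra.
(* Coefficientwise, 2000 * 22 + 2587 * 37 = 139719 exceeds 2000 * 69.857 = 139714, and 2000 * 27 +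
   2587 * 49 = 180763 exceeds 2587 * 69.857 = 180720.059. *)
lra.
Qed.

Theorem theorem1 (R : realType) :
  exists c : R, 0 < c /\
  exists l0 : nat, forall l : nat, (1 <= l)%N -> (l0 <= l)%N ->
  forall p : 'I_(nvert l) -> R * R,
    plane_straight_line (@G_adj l) p ->
    (forall i j : 'I_(nvert l), (i < j)%N -> (p i).1 < (p j).1) ->
    c * (17003%:R / 10000%:R) ^+ nvert l
      <= (num_x_monotone_paths (@G_adj l) p)%:R.
Proof.
(* Since 2587 (x_m + y_m) >= 2000 * 1.7003 ^ (8m) and n = 8m + 2, any constant up to 2000 / 2587 /
   1.7003 ^ 2 = 0.267... works. *)
exists (1 / 4); split; first by lra.
exists 3%N => l _ l3 p _ pP.
have n_gt0 : (0 < nvert l)%N by rewrite /nvert addn2.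
pose x0 := Ordinal n_gt0.
(* With 8m = 2 ^ l, the indices [m * 8] and [m * 8 + 1] are those of the last two vertices. *)
pose m := (2 ^ (l - 3))%N.
have m8 : (m * 8 = 2 ^ l)%N by rewrite -[8%N]/(2 ^ 3)%N -expnD subnK.
have m_gt0 : (0 < m)%N by rewrite expn_gt0.
have mn : (m * 8 + 1 < nvert l)%N by rewrite /nvert; lia.
have walksle : (num_walks (@G_adj l) x0 (m * 8) +
    num_walks (@G_adj l) x0 (m * 8 + 1) <= num_x_monotone_paths (@G_adj l) p)%N.
  have := @num_walks_total _ (@G_adj l) x0 [:: m * 8; m * 8 + 1]%N.
  rewrite !big_cons big_nil addn0 => /(_ _ _)/leq_trans; apply.
  - by rewrite /= inE; lia.
  - by rewrite /= !inE; lia.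
  apply/subset_leq_card/subsetP => s; rewrite !inE => /and3P[s1 su ss].
  rewrite /graph_path s1 su /monotone /=; apply/andP; split.
    by apply: sub_sorted ss => a b /andP[].
  apply: sub_sorted ss => a b /andP[_ ab].
  by rewrite /dot /vec /= mulr1 mulr0 addr0 subr_gt0 pP.
rewrite [X in _ ^+ X](_ : _ = m * 8 + 2)%N ?m8 // exprD -m8.
have := @num_walks_G_ge R l x0 m l3 erefl mn.
move: walksle; rewrite -(ler_nat R) natrD.
have N_ge0 j : 0 <= (num_walks (@G_adj l) x0 j)%:R :> R by [].
move: (N_ge0 (m * 8)%N) (N_ge0 (m * 8 + 1)%N).
move: (_ ^+ (m * 8)) => r.
lra.
Qed.
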